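(* Let $k\ge 2$ be an integer and $(\alpha_1,\dots,\alpha_k)\in(0,\pi)^k$. For every set $E$ of $n$ points in $\mathbb{R}^2$, the number of tuples $(x_1,\dots,x_{k+2})$ with $x_1=0$ (the origin), $x_2,\dots,x_{k+2}\in E$, and $\angle(x_j,x_{j+1},x_{j+2})=\alpha_j$ for all $1\le j\le k$, is $$\lesssim\begin{cases} n^{\frac{k-1}{2}+1}\log n, & k\text{ odd},\\ n^{\frac k2+1}, & k \text{ even}.\end{cases}$$
   Context: $\angle(x,y,z)\in[0,\pi]$ denotes the angle at $y$ between $x-y$ and $z-y$ (for $x\ne y\ne z$). $X(n)\lesssim Y(n)$ means $X(n)\le CY(n)$ for all $n>N$ with constants $C,N$ independent of $n$ (possibly depending on $k$ and the angles). *)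

(* Defs.v *)
From HB Require Import structures.
From mathcomp Require Import all_boot all_order all_algebra finmap.
From mathcomp Require Import reals trigo exp.
Set Implicit Arguments.
Unset Strict Implicit.
Unset Printing Implicit Defensive.
Import Order.TTheory GRing.Theory Num.Theory.
Local Open Scope ring_scope.

Definition dot (R : realType) (u v : 'rV[R]_2) : R := (u *m v^T) 0 0.

(* The library norm on row vectors is the sup norm, hence this definition. *)
Definition enorm (R : realType) (u : 'rV[R]_2) : R := Num.sqrt (dot u u).

(* The angle at y, in [0, pi]; only meaningful when x != y and y != z. *)
Definition angle (R : realType) (x y z : 'rV[R]_2) : R :=
  acos (dot (x - y) (z - y) / (enorm (x - y) * enorm (z - y))).

(* The k.+1 entries of t are x_2, ..., x_{k+2}; x_1 is the origin. Indices
   are shifted down by one. The two inequations say that the angle is defined: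
   [angle] is total and takes the value pi/2 on degenerate triples. *)
Definition pinned_chain (R : realType) (k : nat) (alpha : 'I_k -> R)
    (E : {fset 'rV[R]_2}) (t : k.+1.-tuple E) : bool :=
  let x (i : nat) : 'rV[R]_2 := nth 0 (0 :: map val t) i in
  [forall j : 'I_k, [&& x j != x j.+1, x j.+1 != x j.+2
                      & angle (x j) (x j.+1) (x j.+2) == alpha j]].

Definition num_pinned_chains (R : realType) (k : nat) (alpha : 'I_k -> R)
    (E : {fset 'rV[R]_2}) : nat :=
  #|[pred t : k.+1.-tuple E | pinned_chain alpha t]|.

(* Main.v *)
(* Write [n] for the number of points. A middle point [q] is determined by
   [w, a, b] when the angles at [a] in [(w, a, q)] and at [q] in [(a, q, b)] are
   prescribed as oriented angles modulo pi: [q] lies on a line through [a] and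
   on a circle through [a] and [b]. An angle in (0, pi) leaves two choices of
   such an oriented angle, whence a harmless factor [2 ^ k].
   For [k] even, [x_1 = 0] and the points [x_2, x_4, ..., x_(k+2)] determine the
   others. For [k] odd, [x_1 = 0], the points [x_3, x_5, ..., x_(k-2)] and the
   triple [(x_k, x_(k+1), x_(k+2))] do; by Pach and Sharir there are
   O(n^2 log n) triples with a given angle. Indeed, charge a triple to the
   richer line [l] of its two sides: fixing the ends of the triple, or else
   fixing its two points on [l], shows that [l] receives at most
   [|l| min(n, |l|^2)] triples with the richer side first. Summing over [l] with the
   Szemeredi-Trotter bound O(n^2/t^3 + n/t) on the number of lines with at least
   [t] points leaves O(n^2) times a harmonic sum. Szemeredi-Trotter is derived
   as by Szekely from the crossing inequality. *)
Require Import Defs.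
From HB Require Import structures.
From mathcomp Require Import all_boot all_order all_algebra finmap.
From mathcomp Require Import boolp reals sequences trigo exp.
From mathcomp Require Import ring lra zify.
Set Implicit Arguments.
Unset Strict Implicit.
Unset Printing Implicit Defensive.
Import Order.TTheory GRing.Theory Num.Theory.
Local Open Scope ring_scope.

(** * Plane straight-line graphs *)

Section StraightLineGraphs.
Variables (R : realFieldType) (T : finType) (X Y : T -> R).

(** Edges are pairs listed by increasing [X]. With [X] injective none is vertical, so each is the
    graph of an affine function. *)
Definition slope (e : T * T) : R := (Y e.2 - Y e.1) / (X e.2 - X e.1).

Definition height (e : T * T) (x : R) : R := Y e.1 + slope e * (x - X e.1).

Definition overlap (e f : T * T) : Prop :=
  exists x, [/\ X e.1 < x < X e.2, X f.1 < x < X f.2 & height e x = height f x].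

Lemma height_affine e a b t :
  height e (a + t * (b - a)) = height e a + t * (height e b - height e a).
Proof. rewrite /height; ring. Qed.

Lemma height1 e : height e (X e.1) = Y e.1.
Proof. by rewrite /height subrr mulr0 addr0. Qed.

Lemma height2 e : X e.1 < X e.2 -> height e (X e.2) = Y e.2.
Proof.
move=> lt_e; have ne : X e.2 - X e.1 != 0 by rewrite subr_eq0 gt_eqF.
by rewrite /height /slope divfK // addrC subrK.
Qed.

Lemma height_lt_slope e f x : e.1 = f.1 -> X e.1 < x ->
  (height e x < height f x) = (slope e < slope f).
Proof.
move=> ef ltx; rewrite /height ef ltrD2l ltr_pM2r // subr_gt0 -ef //.
Qed.

(** The difference of two heights is affine, so a strict inequality at [c] persists over a length d
    / (|s| + 1) to the left; the 1 keeps the denominator positive. *)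
Lemma height_lt_left e f b c : height e c < height f c -> b < c ->
  exists b', [/\ b <= b', b' < c &
    forall x, b' < x -> x < c -> height e x < height f x].
Proof.
move=> lt_ef lt_bc.
pose d := height f c - height e c; pose s := slope e - slope f.
have d0 : 0 < d by rewrite subr_gt0.
have s0 : 0 < `|s| + 1 by rewrite ltr_wpDl.
exists (Num.max b (c - d / (`|s| + 1))); split.
- by rewrite le_max lexx.
- by rewrite gt_max lt_bc /= ltrBlDr ltrDl divr_gt0.
move=> x; rewrite gt_max => /andP[_ lt1] ltx.
have lt2 : (c - x) * (`|s| + 1) < d by rewrite -ltr_pdivlMr //; lra.
have le3 : - s * (c - x) <= `|s| * (c - x).
  by apply: ler_wpM2r; [lra | rewrite lerNl; have := lerNnormlW (lexx `|s|)].
have : height f x - height e x = d + s * (c - x).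
  by rewrite /d /s /height; ring.
nra.
Qed.

Hypothesis X_inj : injective X.

Section PlaneGraph.
Variables (S : {set T}) (G : {set T * T}).
Hypothesis G_S : forall e, e \in G -> (e.1 \in S) /\ (e.2 \in S).
Hypothesis G_lt : forall e, e \in G -> X e.1 < X e.2.
Hypothesis G_empty : forall e r, e \in G -> r \in S ->
  X e.1 < X r < X e.2 -> Y r <> height e (X r).
Hypothesis G_plane : forall e f, e \in G -> f \in G -> overlap e f -> e = f.

(** If the order were reversed at [b], the affine difference would vanish strictly in between, an
    overlap of distinct edges. *)
Lemma plane_height_le e f a b : e \in G -> f \in G ->
    X e.1 <= a -> X f.1 <= a -> a < b -> b <= X e.2 -> b <= X f.2 ->
  height e a < height f a -> height e b <= height f b.
Proof.
move=> eG fG ea fa ab be bf lta; rewrite leNgt; apply/negP => ltb.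
pose u := height f a - height e a; pose v := height e b - height f b.
have u0 : 0 < u by rewrite subr_gt0.
have v0 : 0 < v by rewrite subr_gt0.
pose t := u / (u + v).
have uv0 : 0 < u + v by lra.
have t0 : 0 < t by rewrite divr_gt0.
have t1 : t < 1 by rewrite ltr_pdivrMr //; lra.
have tE : t * (u + v) = u by rewrite divfK // gt_eqF.
have ef : e = f.
  apply: G_plane => //; exists (a + t * (b - a)).
  have la : a < a + t * (b - a) by rewrite ltrDl mulr_gt0 // subr_gt0.
  have lb : a + t * (b - a) < b by nra.
  split; try by apply/andP; split; lra.
  rewrite !height_affine; rewrite /u /v in tE; lra.
by move: lta; rewrite ef ltxx.
Qed.

Lemma edge_slope_inj e f : e \in G -> f \in G -> e.1 = f.1 ->
  slope e = slope f -> e = f.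
Proof.
move=> eG fG ef sef; apply: G_plane => //.
have le := G_lt eG; have lf := G_lt fG; rewrite -ef in lf.
exists ((X e.1 + Num.min (X e.2) (X f.2)) / 2).
have h1 : X e.1 < Num.min (X e.2) (X f.2) by rewrite lt_min le.
have h2 : Num.min (X e.2) (X f.2) <= X e.2 by rewrite ge_min lexx.
have h3 : Num.min (X e.2) (X f.2) <= X f.2 by rewrite ge_min lexx orbT.
by split; rewrite -?ef; try (apply/andP; split; lra); rewrite /height ef sef.
Qed.

(** Closed on all sides but the left, so that the nearer right end of the two edges belongs to it
    and a leftmost vertex exists. *)
Definition in_wedge (e f : T * T) (r : T) : Prop :=
  [/\ r \in S, X e.1 < X r, X r <= X e.2, X r <= X f.2 &
      height e (X r) <= Y r <= height f (X r)].

(* [f] is the edge following [e] counterclockwise at their common left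
   endpoint, and [r] is the leftmost vertex between them. No edge enters the
   region between [e] and [f] left of [r], so charging [e] to [r] charges every
   vertex at most twice: once with [r = e.2] and once otherwise. *)
Record gap (e f : T * T) (r : T) : Prop := Gap {
  gapl : e \in G;
  gapu : f \in G;
  gap1 : f.1 = e.1;
  gap_slope : slope e < slope f;
  gap_next : forall g, g \in G -> g.1 = e.1 -> slope e < slope g ->
    slope f <= slope g;
  gap_wedge : in_wedge e f r;
  gap_left : forall s, in_wedge e f s -> X r <= X s }.

Definition topmost (e : T * T) : bool :=
  [forall f in G, (f.1 == e.1) ==> (slope f <= slope e)].

Lemma gap_exists e : e \in G -> ~~ topmost e -> exists z, gap e z.1 z.2.
Proof.
move=> eG; rewrite negb_forall => /existsP[f0].
rewrite !negb_imply -ltNge => P0.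
case: (Order.TotalTheory.arg_minP
  (P := fun f => [&& f \in G, f.1 == e.1 & slope e < slope f]) slope P0) =>
  f /and3P[fG /eqP f1 ltef] fmin.
pose W r := [&& r \in S, X e.1 < X r, X r <= X e.2, X r <= X f.2,
   height e (X r) <= Y r & Y r <= height f (X r)].
have WP r : reflect (in_wedge e f r) (W r).
  apply: (iffP and5P) => [[a b c d h]|[a b c d /andP h]]; split => //;
    exact/andP.
have lt_e := G_lt eG; have lt_f := G_lt fG.
have [r0 Wr0] : exists r, W r.
  have [le_ef|/ltW le_fe] := leP (X e.2) (X f.2).
    exists e.2; apply/WP; split=> //; first by case: (G_S eG).
    rewrite height2 // lexx -(height2 lt_e) ltW // height_lt_slope //.
  exists f.2; apply/WP; split=> //; first by case: (G_S fG).
    by rewrite -f1.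
  by rewrite height2 // lexx -(height2 lt_f) ltW // height_lt_slope // -f1.
case: (Order.TotalTheory.arg_minP X Wr0) => r /WP Wr rmin.
exists (f, r); split=> //= [g gG g1 ltg|s /WP /rmin //].
by apply: fmin; rewrite gG g1 eqxx.
Qed.

(** Follow [g] back to its left end. Starting left of the apex [e.1], it passes below, above or
    through the apex, and so crosses [e], crosses [f] or contains a vertex. Starting right of the
    apex, it either starts outside the wedge and crosses [e] or [f], or starts inside and
    contradicts the choice of [r]. Starting at the apex, it contradicts the choice of [f]. *)
Lemma gap_empty e f r g x : gap e f r -> g \in G ->
    X e.1 < x -> x <= X r -> X g.1 < x -> x <= X g.2 ->
    height e x < height g x -> height g x < height f x -> False.
Proof.
move=> [eG fG f1 lt_s next [rS er re rf /andP[her hfr]] rmin] gG ex xr gx xg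
  lt_eg lt_gf.
have hf : height f (X e.1) = Y e.1 by rewrite -f1 height1.
have [lt_ge|lt_eg1|/X_inj eq_ge] := ltgtP (X g.1) (X e.1).
- have [lt|lt|eq] := ltgtP (height g (X e.1)) (Y e.1).
  + have := @plane_height_le g e (X e.1) x gG eG (ltW lt_ge) (lexx _) ex xg.
    by rewrite height1 => /(_ (le_trans xr re) lt); lra.
  + have := @plane_height_le f g (X e.1) x fG gG.
    rewrite {1}f1 hf => /(_ (lexx _) (ltW lt_ge) ex).
    by move=> /(_ (le_trans xr rf) xg lt); lra.
  + have [eS _] := G_S eG; case: (G_empty gG eS _ (esym eq)).
    by rewrite lt_ge (lt_le_trans ex).
- have [gS _] := G_S gG.
  have [lt|le1] := ltP (Y g.1) (height e (X g.1)).
    have := @plane_height_le g e (X g.1) x gG eG (lexx _) (ltW lt_eg1) gx xg.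
    by rewrite height1 => /(_ (le_trans xr re) lt); lra.
  have [lt|le2] := ltP (height f (X g.1)) (Y g.1).
    have := @plane_height_le f g (X g.1) x fG gG.
    rewrite height1 f1 => /(_ (ltW lt_eg1) (lexx _) gx).
    by move=> /(_ (le_trans xr rf) xg lt); lra.
  suff /rmin : in_wedge e f g.1 by lra.
  split=> //; rewrite ?le1 ?le2 //; lra.
- move: lt_eg lt_gf; rewrite !height_lt_slope ?f1 // => lt1 lt2.
  by have := next g gG eq_ge lt1; lra.
Qed.

Lemma edge_end e r : e \in G -> r \in S -> X e.1 < X r -> X r <= X e.2 ->
  Y r = height e (X r) -> r = e.2.
Proof.
move=> eG rS er; rewrite le_eqVlt => /orP[/eqP/X_inj //|re] Yr.
by case: (G_empty eG rS _ Yr); rewrite er.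
Qed.

(** Equality would put [r] at the right end of [e1], hence, the flags being equal, at the right end
    of [e2], which is strictly below [f2] there. *)
Lemma gap_upper e1 f1 e2 f2 r : gap e1 f1 r -> gap e2 f2 r ->
  (r == e1.2) = (r == e2.2) -> height e1 (X r) < height f2 (X r).
Proof.
move=> [eG1 _ _ _ _ [rS er1 re1 _ /andP[her1 _]] _].
move=> [eG2 fG2 f21 lt2 _ [_ er2 re2 rf2 /andP[_ hfr2]] _] flag.
rewrite lt_neqAle (le_trans her1 hfr2) andbT; apply/eqP => eq.
have Yr : Y r = height e1 (X r) by lra.
have r1 := edge_end eG1 rS er1 re1 Yr.
move: flag; rewrite {1}r1 eqxx => /esym/eqP r2.
have := height_lt_slope (esym f21) er2.
rewrite lt2 -eq -Yr {1 2}r2 height2 ?ltxx // -r2 //.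
Qed.

(** Just left of [r], each lower edge is below the upper edge of the other gap. If [e1] and [e2] had
    different heights there, the higher one would enter the gap of the lower, against [gap_empty];
    equal heights are an overlap. *)
Lemma gap_inj e1 f1 e2 f2 r : gap e1 f1 r -> gap e2 f2 r ->
  (r == e1.2) = (r == e2.2) -> e1 = e2.
Proof.
move=> gap1 gap2 flag.
have lt12 := gap_upper gap1 gap2 flag.
have lt21 := gap_upper gap2 gap1 (esym flag).
case: (gap1) (gap2) => [eG1 _ f11 s1 _ [_ er1 re1 _ _] _].
move=> [eG2 _ f21 s2 _ [_ er2 re2 _ _] _].
have [b1 [lb1 b1r near1]] := height_lt_left lt12 er1.
have [b2 [lb2 b2r near2]] := height_lt_left lt21 er2.
pose b := Num.max b1 b2.
have bb1 : b1 <= b by rewrite le_max lexx.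
have bb2 : b2 <= b by rewrite le_max lexx orbT.
have br : b < X r by rewrite gt_max b1r.
pose x := (b + X r) / 2.
have bx : b < x by rewrite /x; lra.
have xr : x < X r by rewrite /x; lra.
have {}near1 := near1 x (le_lt_trans bb1 bx) xr.
have {}near2 := near2 x (le_lt_trans bb2 bx) xr.
have e1x : X e1.1 < x by lra.
have e2x : X e2.1 < x by lra.
have [lt|lt|eq] := ltgtP (height e1 x) (height e2 x).
- by case: (@gap_empty _ _ _ e2 x gap1) => //; lra.
- by case: (@gap_empty _ _ _ e1 x gap2) => //; lra.
- by apply: G_plane => //; exists x; split=> //; apply/andP; split; lra.
Qed.

(** A linear bound without Euler's formula: a topmost edge is determined by its left end, any other
    edge by its charged vertex and a flag. *)
Theorem plane_graph_edges : (#|G| <= 3 * #|S|)%N.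
Proof.
pose top := [set e in G | topmost e].
have top_le : (#|top| <= #|S|)%N.
  rewrite -(@card_in_imset _ _ fst) => [|e f].
    apply/subset_leq_card/subsetP => p /imsetP[e].
    by rewrite inE => /andP[/G_S[eS _] _] ->.
  rewrite !inE => /andP[eG /forall_inP te] /andP[fG /forall_inP tf] ef.
  apply: edge_slope_inj => //; apply/eqP; rewrite eq_le.
  move: (te f fG) (tf e eG); rewrite -ef eqxx /= => -> ->.
  by [].
pose bot := [set e in G | ~~ topmost e].
have /choice[F FP] (e : T * T) : exists z, e \in bot -> gap e z.1 z.2.
  have [ebot|_] := boolP (e \in bot); last by exists (e, e.1).
  move: (ebot); rewrite inE => /andP[eG /(gap_exists eG)[z ez]].
  by exists z.
have bot_le : (#|bot| <= #|S| * 2)%N.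
  rewrite -card_bool -cardsT -cardsX.
  rewrite -(@card_in_imset _ _ (fun e => ((F e).2, (F e).2 == e.2))) => [|e f].
    apply/subset_leq_card/subsetP => z /imsetP[e /FP[_ _ _ _ _ [rS _ _ _ _] _]].
    by move=> ->; rewrite !inE /= rS.
  move=> /FP ge /FP gf [rr flag]; rewrite -rr in flag gf.
  exact: gap_inj ge gf flag.
rewrite mulSn mulnC (leq_trans _ (leq_add top_le bot_le)) //.
rewrite (leq_trans _ (leq_card_setU top bot)) // subset_leq_card //.
apply/subsetP => e eG; rewrite !inE eG /=; by case: (topmost e).
Qed.

End PlaneGraph.
End StraightLineGraphs.

(** * Crossings and rich lines *)

Lemma sum_card_exchange (I J : finType) (A : {set J}) (P : I -> J -> bool) :
  (\sum_(i : I) #|[set x in A | P i x]| = \sum_(x in A) #|[set i | P i x]|)%N.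
Proof.
under eq_bigr do rewrite -sum1dep_card.
under [RHS]eq_bigr do rewrite -sum1dep_card.
rewrite (exchange_big_dep (mem A)) /= => [|i x _ /andP[] //].
by apply: eq_bigr => x xA; apply: eq_bigl => i; rewrite xA.
Qed.

(** Let S be the class of colour 0 in a uniform random colouring. This is the probability
    (m+1)^(-|A|) that S contains [A], with denominators cleared. *)
Lemma card_monochromatic (T : finType) (m : nat) (A : {set T}) :
  (#|[set c : {ffun T -> 'I_m.+1} | A \subset [set p | c p == ord0]]|
    * m.+1 ^ #|A| = m.+1 ^ #|T|)%N.
Proof.
have -> : #|[set c : {ffun T -> 'I_m.+1} | A \subset [set p | c p == ord0]]|
    = #|pffun_on (ord0 : 'I_m.+1) (~: A) predT|.
  apply: eq_card => c; rewrite inE; apply/idP/pffun_onP => [/subsetP cA|[cA _]].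
    split=> //; apply/subsetP => p; rewrite !inE; apply: contra => /cA.
    by rewrite inE.
  apply/subsetP => p pA; rewrite inE; apply: contraT => cp.
  by have := subsetP cA p cp; rewrite inE pA.
by rewrite card_pffun_on card_ord -expnD addnC cardsC.
Qed.

(** * The crossing inequality for straight-line drawings *)

Section CrossingInequality.
Variables (R : realFieldType) (T : finType) (X Y : T -> R).
Hypothesis X_inj : injective X.
Variable G : {set T * T}.
Hypothesis G_lt : forall e, e \in G -> X e.1 < X e.2.
Hypothesis G_empty : forall e r, e \in G ->
  X e.1 < X r < X e.2 -> Y r <> height X Y e (X r).

Local Notation height := (height X Y).

Lemma height_ext e f a b : a != b -> height e a = height f a ->
  height e b = height f b -> height e =1 height f.
Proof.
move=> ab ea eb x; have ne : b - a != 0 by rewrite subr_eq0 eq_sym.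
have -> : x = a + ((x - a) / (b - a)) * (b - a) by rewrite divfK // addrC subrK.
by rewrite !height_affine ea eb.
Qed.

(** If their left ends or their right ends differed, one of these vertices would be interior to the
    other edge, against [G_empty]. *)
Lemma collinear_overlap e f : e \in G -> f \in G -> overlap X Y e f ->
  height e =1 height f -> e = f.
Proof.
move=> eG fG [x [/andP[e1 e2] /andP[f1 f2] _]] eh.
have le := G_lt eG; have lf := G_lt fG.
rewrite (surjective_pairing e) (surjective_pairing f); congr pair; apply: X_inj.
  have [lt|lt|//] := ltgtP (X e.1) (X f.1); exfalso.
    by apply: (@G_empty e f.1) => //; [lra | rewrite eh height1].
  by apply: (@G_empty f e.1) => //; [lra | rewrite -eh height1].
have [lt|lt|//] := ltgtP (X e.2) (X f.2); exfalso.
  by apply: (@G_empty f e.2) => //; [lra | rewrite -eh height2].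
by apply: (@G_empty e f.2) => //; [lra | rewrite eh height2].
Qed.

Definition crossings : {set (T * T) * (T * T)} :=
  [set z | [&& z.1 \in G, z.2 \in G, z.1 != z.2 & `[< overlap X Y z.1 z.2 >]]].

Definition ends (e : T * T) : {set T} := [set e.1; e.2].

Lemma card_ends e : e \in G -> #|ends e| = 2%N.
Proof.
by move=> /G_lt lt; rewrite cards2; case: eqP lt => // ->; rewrite ltxx.
Qed.

(** A common end, together with the crossing point, would make the edges collinear, hence equal.
    Four distinct ends give a crossing the survival probability M^(-4). *)
Lemma card_crossing_ends z : z \in crossings -> #|ends z.1 :|: ends z.2| = 4%N.
Proof.
rewrite inE => /and4P[eG fG ef /asboolP ov].
case: (ov) => x [/andP[e1 e2] /andP[f1 f2] h].
rewrite cardsU !card_ends //.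
suff -> : ends z.1 :&: ends z.2 = set0 by rewrite cards0.
apply/setP => p; rewrite !inE; apply/negP => /andP[pe pf].
move/eqP: ef; apply; apply: collinear_overlap => //.
case/orP: pe => /eqP pe; case/orP: pf => /eqP pf; last first.
- apply: (height_ext _ h (b := X p)); first by rewrite lt_eqF // pe.
  by rewrite {1}pe pf !height2 ?G_lt // -pe -pf.
- by move: (lt_trans f1 e2); rewrite -pe -pf ltxx.
- by move: (lt_trans e1 f2); rewrite -pe -pf ltxx.
- apply: (height_ext _ h (b := X p)); first by rewrite gt_eqF // pe.
  by rewrite {1}pe pf !height1 // -pe -pf.
Qed.

(** Deleting the first edge of every crossing inside [S] leaves a plane graph. *)
Lemma crossings_ge (S : {set T}) : (#|[set e in G | ends e \subset S]| <=
  3 * #|S| + #|[set z in crossings | ends z.1 :|: ends z.2 \subset S]|)%N.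
Proof.
set GS := [set e in G | _]; set CS := [set z in _ | _].
pose P := GS :\: [set z.1 | z in CS].
have Ple : (#|P| <= 3 * #|S|)%N.
  apply: (plane_graph_edges (Y := Y) X_inj).
  - move=> e /setDP[]; rewrite inE => /andP[_ /subsetP eS] _.
    by split; apply: eS; rewrite !inE eqxx ?orbT.
  - by move=> e /setDP[]; rewrite inE => /andP[/G_lt].
  - by move=> e r /setDP[]; rewrite inE => /andP[/G_empty eG _ _ _]; apply: eG.
  move=> e f /setDP[eGS eC] /setDP[fGS _] ov; apply/eqP; apply: contraT => ef.
  case/negP: eC; apply/imsetP; exists (e, f) => //.
  move: eGS fGS; rewrite !inE /= => /andP[-> eS] /andP[-> fS].
  rewrite ef /= subUset eS fS !andbT; exact/asboolP.
rewrite -(cardsID [set z.1 | z in CS] GS) addnC leq_add //.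
by apply: leq_trans (leq_imset_card fst _); rewrite subset_leq_card // subsetIr.
Qed.

(* Average [crossings_ge] over a random [S] containing each vertex with
   probability 1/M. *)
Theorem crossing_inequality (M : nat) : (0 < M)%N ->
  (#|G| * M ^ 2 <= 3 * #|T| * M ^ 3 + #|crossings|)%N.
Proof.
case: M => // m _.
pose S (c : {ffun T -> 'I_m.+1}) := [set p | c p == ord0].
have : (\sum_c #|[set e in G | ends e \subset S c]| <=
  3 * \sum_c #|[set p in setT | [set p] \subset S c]| +
  \sum_c #|[set z in crossings | ends z.1 :|: ends z.2 \subset S c]|)%N.
  rewrite big_distrr -big_split leq_sum //= => c _.
  rewrite (leq_trans (crossings_ge (S c))) // leq_add2r leq_mul2l /=.
  by apply/subset_leq_card/subsetP => p; rewrite !inE sub1set inE.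
(* With M = m+1, multiplying by M^4 gives edges, vertices and crossings the weights M^2, M^3 and 1,
   up to the common factor M^|T|. *)
rewrite !sum_card_exchange /S -(@leq_pmul2r (m.+1 ^ 4)) ?expn_gt0 //.
rewrite mulnDl -mulnA !big_distrl /=.
under eq_bigr => e eG.
  rewrite (_ : 4 = #|ends e| + 2)%N; last by rewrite card_ends.
  rewrite expnD mulnA.
  rewrite card_monochromatic; over.
under [X in (_ <= 3 * X + _)%N]eq_bigr => p _.
  rewrite (_ : 4 = #|[set p]| + 3)%N; last by rewrite cards1.
  rewrite expnD mulnA.
  rewrite card_monochromatic; over.
under [X in (_ <= _ + X)%N]eq_bigr => z zC.
  rewrite -(card_crossing_ends zC) card_monochromatic; over.
rewrite !sum_nat_const cardsT.
set N := (_ ^ #|T|)%N => le; rewrite -(@leq_pmul2l N) ?expn_gt0 //.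
by move: le; congr leq; ring.
Qed.

End CrossingInequality.

(** * Lines spanned by a finite set of points *)

Section Lines.
Variables (R : realFieldType) (T : finType) (X Y : T -> R).

(** A line is encoded by its trace on the points. For [p = q] the equation is trivial and the trace
    is all of [T], which is why [lines] takes distinct pairs. *)
Definition line (p q : T) : {set T} :=
  [set r | (X q - X p) * (Y r - Y p) == (X r - X p) * (Y q - Y p)].

Definition lines : {set {set T}} :=
  [set line e.1 e.2 | e in [set e : T * T | e.1 != e.2]].

Lemma mem_line1 p q : p \in line p q.
Proof. by rewrite inE !subrr mul0r mulr0. Qed.

Lemma mem_line2 p q : q \in line p q.
Proof. by rewrite inE. Qed.

Lemma line_in_lines p q : p != q -> line p q \in lines.
Proof. by move=> pq; apply/imsetP; exists (p, q); rewrite ?inE. Qed.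

Lemma lineC p q : line p q = line q p.
Proof.
apply/setP => r; rewrite !inE -subr_eq0 -[RHS]subr_eq0 -[LHS]oppr_eq0.
by congr (_ == 0); ring.
Qed.

Hypothesis XY_inj : forall p q, X p = X q -> Y p = Y q -> p = q.

Lemma vector_neq0 p q : p != q -> (X q - X p != 0) || (Y q - Y p != 0).
Proof.
rewrite -negb_and; apply: contra => /andP[].
by rewrite !subr_eq0 => /eqP Xpq /eqP Ypq; apply/eqP/esym/XY_inj.
Qed.

Lemma line_eq p q r s : p != q -> r != s -> r \in line p q -> s \in line p q ->
  line r s = line p q.
Proof.
rewrite !inE => pq rs /eqP hr /eqP hs; apply/setP => t; rewrite !inE.
rewrite -subr_eq0 -[RHS]subr_eq0.
set D := (X in (X == 0) = _); set D' := (X in _ = (X == 0)).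
pose hr' := (X q - X p) * (Y r - Y p) - (X r - X p) * (Y q - Y p).
pose hs' := (X q - X p) * (Y s - Y p) - (X s - X p) * (Y q - Y p).
(* [D] and [D'] test [t] against the two lines. The vectors D (q - p) and D' (s - r) agree in both
   coordinates, and neither direction is zero. *)
have e1 : (X q - X p) * D = (X s - X r) * D'.
  apply/eqP; rewrite -subr_eq0; apply/eqP.
  transitivity ((X r - X t) * (hs' - hr') - (X s - X r) * hr').
    by rewrite /D /D' /hs' /hr'; ring.
  by rewrite /hs' /hr' hr hs; ring.
have e2 : (Y q - Y p) * D = (Y s - Y r) * D'.
  apply/eqP; rewrite -subr_eq0; apply/eqP.
  transitivity ((Y r - Y t) * (hs' - hr') - (Y s - Y r) * hr').
    by rewrite /D /D' /hs' /hr'; ring.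
  by rewrite /hs' /hr' hr hs; ring.
apply/eqP/eqP => D0.
  move: e1 e2; rewrite D0 !mulr0 => /esym/eqP e1 /esym/eqP e2.
  move: e1 e2; rewrite !mulf_eq0.
  have [//|_] := eqVneq D' 0; rewrite !orbF => e1 e2.
  by have := vector_neq0 rs; rewrite e1 e2.
move: e1 e2; rewrite D0 !mulr0 => /eqP e1 /eqP e2.
move: e1 e2; rewrite !mulf_eq0.
have [//|_] := eqVneq D 0; rewrite !orbF => e1 e2.
by have := vector_neq0 pq; rewrite e1 e2.
Qed.

Lemma lines_line l p q : l \in lines -> p \in l -> q \in l -> p != q ->
  l = line p q.
Proof.
case/imsetP => [[a b]]; rewrite inE /= => ab -> pl ql pq.
exact/esym/line_eq.
Qed.

End Lines.

(** * The Szemeredi-Trotter bound on rich lines *)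

Section SzemerediTrotter.
Variables (R : realFieldType) (T : finType) (X Y : T -> R).
Hypothesis X_inj : injective X.

Local Notation line := (line X Y).
Local Notation lines := (lines X Y).
Local Notation height := (height X Y).

Let XY_inj p q : X p = X q -> Y p = Y q -> p = q.
Proof. by move=> /X_inj. Qed.

Lemma mem_line_height p q r : p != q ->
  (r \in line p q) = (Y r == height (p, q) (X r)).
Proof.
move=> pq; have ne : X q - X p != 0.
  by rewrite subr_eq0; apply: contra pq => /eqP/X_inj ->.
rewrite inE /height /slope /= -subr_eq0 -[RHS]subr_eq0.
rewrite -[RHS](mulIr_eq0 _ (mulIf ne)); congr (_ == 0); field.
exact: ne.
Qed.

Lemma line_height e f : e.1 != e.2 -> f.1 != f.2 ->
  line e.1 e.2 = line f.1 f.2 -> height e =1 height f.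
Proof.
case: e f => [p q] [p' q'] /= pq pq' eql.
have ne : X p != X q by apply: contra pq => /eqP/X_inj ->.
have on r : r \in line p q -> height (p, q) (X r) = height (p', q') (X r).
  move=> rl; have := rl; rewrite mem_line_height // => /eqP <-.
  by move: rl; rewrite eql mem_line_height // => /eqP.
apply: (height_ext ne); apply: on; [exact: mem_line1 | exact: mem_line2].
Qed.

(** The inequality is strict so that a rich line carries at least [t] edges between consecutive
    points. *)
Definition rich (t : nat) : {set {set T}} := [set l in lines | (t < #|l|)%N].

(* Szekely's graph. *)
Definition line_edges (L : {set {set T}}) : {set T * T} :=
  [set e | [&& X e.1 < X e.2, line e.1 e.2 \in L &
     [forall r in line e.1 e.2, ~~ (X e.1 < X r < X e.2)]]].

Lemma line_edges_neq L e : e \in line_edges L -> e.1 != e.2.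
Proof.
by rewrite inE => /and3P[lt _ _]; apply: contraTneq lt => ->; rewrite ltxx.
Qed.

Lemma line_edges_lt L e : e \in line_edges L -> X e.1 < X e.2.
Proof. by rewrite inE => /and3P[]. Qed.

Lemma line_edges_empty L e r : e \in line_edges L ->
  X e.1 < X r < X e.2 -> Y r <> height e (X r).
Proof.
move=> eG er /eqP; have ne := line_edges_neq eG; move: eG er.
rewrite {3}(surjective_pairing e) -mem_line_height //.
by rewrite inE => /and3P[_ _ /forall_inP h] er /h; rewrite er.
Qed.

(** Every point of [l] but the rightmost is the left end of the edge to its successor. *)
Lemma card_line_edges l : l \in lines ->
  (#|l|.-1 <= #|line_edges [set l]|)%N.
Proof.
move=> lL; have [z0 z0l] : exists z, z \in l.
  by case/imsetP: lL => e _ ->; exists e.1; apply: mem_line1.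
case: (Order.TotalTheory.arg_maxP (P := mem l) X z0l) => z /= zl zmax.
rewrite (cardsD1 z) [z \in l]zl add1n /=.
apply: leq_trans (leq_imset_card fst _); apply/subset_leq_card/subsetP => r.
rewrite !inE => /andP[rz rl].
have rz0 : (z \in l) && (X r < X z).
  rewrite [z \in l]zl lt_neqAle zmax // andbT.
  by apply: contra rz => /eqP/X_inj ->.
case: (Order.TotalTheory.arg_minP
  (P := fun s => (s \in l) && (X r < X s)) X rz0).
move=> s /andP[sl rs] smin.
have rsN : r != s by apply: contraTneq rs => ->; rewrite ltxx.
have lE := lines_line XY_inj lL rl sl rsN.
apply/imsetP; exists (r, s) => //; rewrite !inE /= rs -lE eqxx /=.
apply/forall_inP => q ql; apply/negP => /andP[rq].
by rewrite ltNge smin // ql.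
Qed.

Lemma card_line_edges_rich t : (#|rich t| * t <= #|line_edges (rich t)|)%N.
Proof.
rewrite -[leqRHS]sum1_card.
rewrite (partition_big (fun e => line e.1 e.2) (mem (rich t))) /=; last first.
  by move=> e; rewrite inE => /and3P[].
rewrite -sum_nat_const leq_sum // => l; rewrite inE => /andP[lL lt].
apply: leq_trans (_ : #|l|.-1 <= _)%N; first by case: #|l| lt.
apply: leq_trans (card_line_edges lL) _; rewrite sum1dep_card.
apply/subset_leq_card/subsetP => e; rewrite !inE => /and3P[-> /eqP le ->].
by rewrite le eqxx lL lt.
Qed.

(** Distinct lines meet at most once, and the meeting point is interior to at most one edge of each,
    so a crossing is determined by its two lines. *)
Lemma card_crossings_lines L :
  (#|crossings X Y (line_edges L)| <= #|L| ^ 2)%N.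
Proof.
rewrite -mulnn -cardsX.
rewrite -(@card_in_imset _ _ (fun z => (line z.1.1 z.1.2, line z.2.1 z.2.2))).
  apply/subset_leq_card/subsetP => y /imsetP[z zC ->].
  rewrite inE in zC; case/and4P: zC => eG fG _ _.
  by move: eG fG; rewrite !inE => /and3P[_ eL _] /and3P[_ fL _]; rewrite eL fL.
move=> [e f] [e' f'] zC zC' [/= le lf]; rewrite inE in zC; rewrite inE in zC'.
case/and4P: zC => /= eG fG /eqP ef /asboolP ov.
case/and4P: zC' => /= eG' fG' _ /asboolP ov'.
have he := line_height (line_edges_neq eG) (line_edges_neq eG') le.
have hf := line_height (line_edges_neq fG) (line_edges_neq fG') lf.
have same := collinear_overlap X_inj (@line_edges_lt L) (@line_edges_empty L).
case: (ov) => x [ex fx hx]; case: (ov') => x' [ex' fx' hx'].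
have xx : x = x'.
  apply/eqP; apply: contraT => ne; case: ef; apply: same => //.
  by apply: (height_ext ne) => //; rewrite he hf.
rewrite -xx in ex' fx'.
by congr pair; apply: same => //; exists x.
Qed.

(** The bound O(n^2/t^3 + n/t) as a single inequality without division. *)
Lemma rich_lines_X_inj t : (0 < t)%N ->
  (#|rich t| * t.+1 * minn (t.+1 ^ 2) #|T| <= 2304 * #|T| ^ 2)%N.
Proof.
move=> t0; set l := #|_|; set n := #|T|.
have [->//|l0] := posnP l.
have n0 : (0 < n)%N.
  rewrite /n; case/card_gt0P: l0 => A; rewrite inE => /andP[_ lt].
  exact: leq_trans (leq_ltn_trans _ lt) (max_card _).
have ineq M : (0 < M)%N -> (l * t * M ^ 2 <= 3 * n * M ^ 3 + l ^ 2)%N.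
  move=> M0; pose L := rich t.
  have := crossing_inequality X_inj (@line_edges_lt L) (@line_edges_empty L) M0.
  have := card_crossings_lines L; have := card_line_edges_rich t.
  rewrite -/L -/l -/n => h1 h2 h3.
  rewrite (leq_trans _ (leq_trans h3 _)) // ?leq_mul2r ?h1 ?orbT //.
  by rewrite leq_add2l.
(* In the first case the [M] chosen below would be 0, but the term n/t suffices. *)
have [lt|ge] := ltnP (l * t) (6 * n).
  have h : (l * t.+1 <= 12 * n)%N by nia.
  by rewrite (leq_trans (leq_mul h (geq_minr _ _))) //; nia.
(* The largest [M] for which the vertex term is at most half the edge term. This yields l t^3 <= 288
   n^2, and passing from t to t+1 costs the factor 8 in 2304. *)
pose M := (l * t %/ (6 * n))%N.
have M0 : (0 < M)%N by rewrite divn_gt0 // muln_gt0.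
have M1 : (6 * n * M <= l * t)%N by rewrite mulnC leq_trunc_div.
have M2 : (l * t < 6 * n * M.+1)%N
  by rewrite [ltnRHS]mulnC ltn_ceil // muln_gt0.
have M3 : (l * t <= 12 * n * M)%N by nia.
have h1 : (l * t * M ^ 2 <= 2 * l ^ 2)%N.
  have : (6 * n * M * M ^ 2 <= l * t * M ^ 2)%N by rewrite leq_mul2r M1 orbT.
  have := ineq M M0.
  by rewrite (expnS M 2); nia.
have h2 : ((l * t) ^ 2 <= (12 * n * M) ^ 2)%N by rewrite leq_exp2r.
have h3 : (l * t * (l * t) ^ 2 <= 288 * n ^ 2 * l ^ 2)%N.
  rewrite (leq_trans (leq_mul (leqnn _) h2)) //.
  have -> : (l * t * (12 * n * M) ^ 2 = 144 * n ^ 2 * (l * t * M ^ 2))%N by ring.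
  have -> : (288 * n ^ 2 * l ^ 2 = 144 * n ^ 2 * (2 * l ^ 2))%N by ring.
  by rewrite leq_mul2l h1 orbT.
have h4 : (l * t ^ 3 <= 288 * n ^ 2)%N.
  rewrite -(@leq_pmul2r (l ^ 2)) ?expn_gt0 ?l0 //.
  by move: h3; congr leq; ring.
rewrite (leq_trans (leq_mul (leqnn _) (geq_minl _ _))) //.
have h5 : (t.+1 ^ 3 <= 8 * t ^ 3)%N.
  by rewrite (_ : 8 = 2 ^ 3)%N // -expnMn leq_exp2r //; lia.
rewrite -mulnA -expnS (leq_trans (leq_mul (leqnn _) h5)) //.
by rewrite mulnCA (_ : 2304 = 8 * 288)%N // -mulnA leq_mul2l h4 orbT.
Qed.

End SzemerediTrotter.

(** A pair of points at different heights gets equal abscissas only for the coefficient [bad];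
    exceeding the sum of all absolute values avoids each of these. *)
Lemma injective_shear (R : realFieldType) (T : finType) (X Y : T -> R) :
  (forall p q, X p = X q -> Y p = Y q -> p = q) ->
  exists c, injective (fun p => X p + c * Y p).
Proof.
move=> XY_inj; pose bad (z : T * T) := (X z.2 - X z.1) / (Y z.1 - Y z.2).
exists (1 + \sum_z `|bad z|) => p q /eqP; rewrite -subr_eq0 => /eqP h.
have [Ypq|] := eqVneq (Y p) (Y q).
  by apply: XY_inj => //; apply/eqP; rewrite -subr_eq0 -h Ypq; apply/eqP; ring.
rewrite -subr_eq0 => ne; exfalso.
have : bad (p, q) <= \sum_z `|bad z|.
  rewrite (bigD1 (p, q)) //= (le_trans (ler_norm _)) // lerDl sumr_ge0 //.
suff -> : bad (p, q) = 1 + \sum_z `|bad z| by lra.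
rewrite /bad /=; apply: (mulIf ne); rewrite divfK //; lra.
Qed.

Lemma line_shear (R : realFieldType) (T : finType) (X Y : T -> R) c p q :
  line (fun p => X p + c * Y p) Y p q = line X Y p q.
Proof.
apply/setP => r; rewrite !inE -subr_eq0 -[RHS]subr_eq0.
by congr (_ == 0); ring.
Qed.

Theorem rich_lines (R : realFieldType) (T : finType) (X Y : T -> R) (t : nat) :
  (forall p q, X p = X q -> Y p = Y q -> p = q) -> (0 < t)%N ->
  (#|rich X Y t| * t.+1 * minn (t.+1 ^ 2) #|T| <= 2304 * #|T| ^ 2)%N.
Proof.
move=> /injective_shear[c c_inj] t0.
have linesE : lines X Y = lines (fun p => X p + c * Y p) Y.
  by apply: eq_imset => e; rewrite line_shear.
by have := @rich_lines_X_inj _ _ _ Y c_inj t t0; rewrite /rich -linesE.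
Qed.

(** * Triples with a given angle *)

(** Turns the weight of a line into a sum over richness thresholds. The constant 3 comes from
    (s+1)^3 - s^3 <= 3 (s+1)^2. *)
Lemma cube_min_le_sum (n s : nat) :
  (s * minn (s ^ 2) n <= 3 * \sum_(i < s) minn (i.+1 ^ 2) n)%N.
Proof.
elim: s => [|s IHs]; first by rewrite mul0n.
rewrite big_ord_recr /= mulnDr.
suff : (s.+1 * minn (s.+1 ^ 2) n <=
    s * minn (s ^ 2) n + 3 * minn (s.+1 ^ 2) n)%N.
  by move=> le; rewrite (leq_trans le) // leq_add2r.
by rewrite /minn; case: ifP; case: ifP; nia.
Qed.

Section CollinearTriples.
Variables (R : realFieldType) (T : finType) (X Y : T -> R).
Hypothesis XY_inj : forall p q, X p = X q -> Y p = Y q -> p = q.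

Local Notation line := (line X Y).
Local Notation lines := (lines X Y).
Local Notation rich := (rich X Y).
Local Notation n := #|T|.

Definition line_energy : nat := (\sum_(l in lines) #|l| * minn (#|l| ^ 2) n)%N.

Lemma rich_weight t :
  (#|rich t| * t.+1 * minn (t.+1 ^ 2) n <= 2304 * n ^ 2)%N.
Proof.
(* Every line has two points, so [rich 0] is contained in [rich 1] and the bound at 1 applies. *)
case: t => [|t]; last exact: rich_lines.
apply: leq_trans (rich_lines XY_inj (ltn0Sn 0)).
rewrite !leq_mul //; last by rewrite leq_min !geq_min /= leqnn orbT.
apply/subset_leq_card/subsetP => l; rewrite !inE => /andP[lL _].
rewrite lL /=; case/imsetP: lL => [[p q]]; rewrite inE /= => pq ->.
rewrite -[2%N](_ : #|[set p; q]| = 2)%N; last by rewrite cards2 pq.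
by apply/subset_leq_card/subsetP => r /set2P[] ->; rewrite ?mem_line1 ?mem_line2.
Qed.

(** Summation by thresholds: a line [l] counts in [rich i] for each i < |l|, and by [rich_weight]
    threshold [i] contributes at most 2304 n^2/(i+1). *)
Lemma line_energy_le :
  line_energy%:R <= 3 * 2304 * n%:R ^+ 2 * \sum_(i < n) (i.+1%:R)^-1 :> R.
Proof.
have le1 : (line_energy <= 3 * \sum_(i < n) #|rich i| * minn (i.+1 ^ 2) n)%N.
  have -> : (\sum_(i < n) #|rich i| * minn (i.+1 ^ 2) n =
      \sum_(l in lines) \sum_(i < n | i < #|l|) minn (i.+1 ^ 2) n)%N.
    rewrite (exchange_big_dep xpredT) //=; apply: eq_bigr => i _.
    rewrite sum_nat_cond_const; congr muln.
  rewrite big_distrr leq_sum //= => l _.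
  rewrite (leq_trans (cube_min_le_sum _ _)) //.
  have h : (#|l| <= n)%N by exact: max_card.
  by rewrite -(big_ord_widen_cond n xpredT (fun i => minn (i.+1 ^ 2) n) h).
rewrite (le_trans
  (_ : _ <= (3 * \sum_(i < n) #|rich i| * minn (i.+1 ^ 2) n)%:R)) //.
  by rewrite ler_nat.
rewrite natrM natr_sum.
have -> (x y : R) : 3 * 2304 * x * y = 3 * (2304 * x * y) by ring.
rewrite ler_pM2l // mulr_sumr ler_sum // => i _.
rewrite ler_pdivlMr // -natrX -!natrM ler_nat mulnAC.
exact: rich_weight.
Qed.

Section Rotation.
Variable A : T -> T -> T -> bool.
Hypothesis A_neq : forall p q r, A p q r -> p != q.
Hypothesis A_ray : forall p q r r', A p q r -> A p q r' -> r' \in line q r.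
Hypothesis A_mid : forall p q q' r, A p q r -> A p q' r ->
  q' \in line p q -> q = q'.

Lemma card_angles_half :
  (#|[set z : T * T * T | A z.1.1 z.1.2 z.2 &&
      (#|line z.1.2 z.2| <= #|line z.1.1 z.1.2|)]| <= line_energy)%N.
Proof.
set H := [set z | _].
rewrite -sum1_card.
rewrite (partition_big (fun z => line z.1.1 z.1.2) (mem lines)) /=; last first.
  by move=> z; rewrite inE => /andP[/A_neq/line_in_lines].
apply: leq_sum => l lL; rewrite sum1dep_card; set Hl := [set z | _].
have HlP z : z \in Hl -> [/\ A z.1.1 z.1.2 z.2, (#|line z.1.2 z.2| <= #|l|)%N &
    line z.1.1 z.1.2 = l].
  by rewrite !inE => /andP[/andP[Az le] /eqP <-].
have Hl_l z : z \in Hl -> (z.1.1 \in l) && (z.1.2 \in l).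
  by case/HlP => _ _ <-; rewrite mem_line1 mem_line2.
(* The ends of a triple, the first of them on [l], determine its middle point by [A_mid]. *)
have le_n : (#|Hl| <= #|l| * n)%N.
  rewrite -cardsT -cardsX -(@card_in_imset _ _ (fun z => (z.1.1, z.2))).
    apply/subset_leq_card/subsetP => y /imsetP[z /Hl_l/andP[pl _] ->].
    by rewrite !inE pl.
  move=> [[p q] r] [[p' q'] r'] /HlP[/= Az _ lz] /HlP[/= Az' _ lz'] [pp rr].
  rewrite -pp -rr in Az' lz' *.
  by rewrite (A_mid Az Az') // lz -lz' mem_line2.
(* Two points on [l] confine the third, by [A_ray], to a line that is no richer than [l]. *)
have le_l : (#|Hl| <= #|l| * #|l| ^ 2)%N.
  rewrite -mulnn mulnA -cardsX -sum_nat_const.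
  rewrite -[leqLHS]sum1_card (partition_big fst (mem (setX l l))) /=; last first.
    by move=> z /Hl_l h; rewrite inE.
  apply: leq_sum => pq _; rewrite sum1dep_card; set F := [set z | _].
  have [->|[z0]] := set_0Vmem F; first by rewrite cards0.
  rewrite inE => /andP[/HlP[Az0 le0 _] /eqP e0].
  apply: leq_trans le0; rewrite -(@card_in_imset _ _ snd).
    apply/subset_leq_card/subsetP => y /imsetP[z]; rewrite inE.
    move=> /andP[/HlP[Az _ _] /eqP ez] ->.
    by apply: (A_ray Az0); rewrite e0 -ez.
  move=> [pq1 r1] [pq2 r2]; rewrite !inE /=.
  by move=> /andP[_ /eqP ->] /andP[_ /eqP ->] ->.
by rewrite /minn; case: ifP.
Qed.

End Rotation.

(** Either the triple or its reversal has the richer side first. The hypotheses come in pairs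
    exchanged by reversal, so [card_angles_half] applies to both orders. *)
Lemma card_angles (A : T -> T -> T -> bool) :
    (forall p q r, A p q r -> (p != q) && (q != r)) ->
    (forall p q r r', A p q r -> A p q r' -> r' \in line q r) ->
    (forall p p' q r, A p q r -> A p' q r -> p' \in line q p) ->
    (forall p q q' r, A p q r -> A p q' r -> q' \in line p q -> q = q') ->
    (forall p q q' r, A p q r -> A p q' r -> q' \in line r q -> q = q') ->
  (#|[set z : T * T * T | A z.1.1 z.1.2 z.2]| <= 2 * line_energy)%N.
Proof.
move=> A_neq A_ray A_ray' A_mid A_mid'.
pose H (B : T -> T -> T -> bool) := [set z : T * T * T | B z.1.1 z.1.2 z.2 &&
  (#|line z.1.2 z.2| <= #|line z.1.1 z.1.2|)%N].
pose A' p q r := A r q p.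
pose swap (z : T * T * T) := ((z.2, z.1.2), z.1.1).
have le1 : (#|H A| <= line_energy)%N.
  by apply: card_angles_half => // p q r /A_neq/andP[].
have le2 : (#|H A'| <= line_energy)%N.
  apply: card_angles_half => [p q r|p q r r'|p q q' r]; rewrite /A'.
  - by move=> /A_neq/andP[_]; rewrite eq_sym.
  - exact: A_ray'.
  - exact: A_mid'.
rewrite mul2n -addnn (leq_trans _ (leq_add le1 le2)) //.
rewrite -(card_imset (H A') (_ : injective swap)); last first.
  by move=> [[p q] r] [[p' q'] r'] [-> -> ->].
rewrite (leq_trans _ (leq_card_setU _ _)) // subset_leq_card //.
apply/subsetP => -[[p q] r]; rewrite !inE /= => Az; rewrite Az /=.
have [//|/ltnW le] := leqP.
by apply/imsetP; exists ((r, q), p); rewrite ?inE //= /A' Az lineC (lineC _ _ r).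
Qed.

End CollinearTriples.

(** * Oriented angles modulo pi, in coordinates *)

Section Angles.
Variable R : realType.
Implicit Types p q r : 'rV[R]_2.

Definition crossv (u v : 'rV[R]_2) : R := u 0 0 * v 0 1 - v 0 0 * u 0 1.

Lemma dotE (u v : 'rV[R]_2) : dot u v = u 0 0 * v 0 0 + u 0 1 * v 0 1.
Proof.
rewrite /dot mxE !big_ord_recl big_ord0 addr0 !mxE.
by congr (_ + u 0 _ * v 0 _); apply/val_inj.
Qed.

Lemma rV2P (u v : 'rV[R]_2) : u 0 0 = v 0 0 -> u 0 1 = v 0 1 -> u = v.
Proof.
move=> e0 e1; apply/rowP => i.
have [->|->] : i = 0 \/ i = 1.
  by case: i => [[|[|//]] ?]; [left|right]; apply/val_inj.
- exact: e0.
- exact: e1.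
Qed.

(* The oriented angle from [p - q] to [r - q], modulo pi, has cotangent
   [kappa]. *)
Definition cot_angle (kappa : R) (p q r : 'rV[R]_2) : bool :=
  (crossv (p - q) (r - q) != 0) &&
  (dot (p - q) (r - q) == kappa * crossv (p - q) (r - q)).

Lemma cot_angle_rev kappa p q r :
  cot_angle kappa p q r -> cot_angle (- kappa) r q p.
Proof.
rewrite /cot_angle !dotE /crossv => /andP[ne /eqP e]; apply/andP; split.
  by move: ne; rewrite -oppr_eq0; congr (_ != 0); ring.
apply/eqP; rewrite mulNr -mulrN; move: e.
by rewrite mulrC (mulrC ((p - q) 0 1)) => ->; ring.
Qed.

Lemma cot_angle_neq kappa p q r : cot_angle kappa p q r -> (p != q) && (q != r).
Proof.
case/andP => ne _; apply/andP; split; apply: contraNneq ne => ->.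
  by rewrite /crossv subrr !mxE; apply/eqP; ring.
by rewrite /crossv subrr !mxE; apply/eqP; ring.
Qed.

(** With u = p - q, the condition on w = r - q is linear: w is orthogonal to v = (u1 + kappa u2, u2
    - kappa u1). Since u.v = |u|^2, v is nonzero, so any two solutions are parallel. *)
Lemma cot_angle_ray kappa p q r r' : cot_angle kappa p q r ->
  cot_angle kappa p q r' -> crossv (r - q) (r' - q) = 0.
Proof.
rewrite /cot_angle !dotE /crossv.
move: (p - q) (r - q) (r' - q) => u w w' /andP[ne /eqP e] /andP[_ /eqP e'].
move: (u 0 0) (u 0 1) (w 0 0) (w 0 1) (w' 0 0) (w' 0 1) ne e e'.
move=> u1 u2 w1 w2 w1' w2' ne e e'.
have z1 : (u1 + kappa * u2) * w1 + (u2 - kappa * u1) * w2 = 0.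
  by rewrite -[RHS](subrr (u1 * w1 + u2 * w2)) {2}e; ring.
have z2 : (u1 + kappa * u2) * w1' + (u2 - kappa * u1) * w2' = 0.
  by rewrite -[RHS](subrr (u1 * w1' + u2 * w2')) {2}e'; ring.
set v1 := u1 + _ in z1 z2; set v2 := u2 - _ in z1 z2.
have c1 : v1 * (w1 * w2' - w1' * w2) = 0.
  transitivity (w2' * (v1 * w1 + v2 * w2) - w2 * (v1 * w1' + v2 * w2'));
    first ring.
  by rewrite z1 z2; ring.
have c2 : v2 * (w1 * w2' - w1' * w2) = 0.
  transitivity (w1 * (v1 * w1' + v2 * w2') - w1' * (v1 * w1 + v2 * w2));
    first ring.
  by rewrite z1 z2; ring.
apply: contraNeq ne => c0; apply/eqP.
have /eqP := c1; rewrite mulf_eq0 (negPf c0) orbF => /eqP v10.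
have /eqP := c2; rewrite mulf_eq0 (negPf c0) orbF => /eqP v20.
have : u1 ^+ 2 + u2 ^+ 2 = u1 * v1 + u2 * v2 by rewrite /v1 /v2; ring.
rewrite v10 v20 !mulr0 addr0 => /eqP.
rewrite paddr_eq0 ?sqr_ge0 // !sqrf_eq0 => /andP[/eqP -> /eqP ->].
by rewrite mul0r mulr0 subrr.
Qed.

(** With [p] as origin, u = q - p lies on the circle |u|^2 = u.v through the origin, where v depends
    only on [kappa] and r - p. A line through the origin meets it in at most one other point. *)
Lemma cot_angle_mid kappa p q q' r : cot_angle kappa p q r ->
  cot_angle kappa p q' r -> crossv (q - p) (q' - p) = 0 -> q = q'.
Proof.
have cE x : cot_angle kappa p x r =
    (crossv (- (x - p)) ((r - p) - (x - p)) != 0) &&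
    (dot (- (x - p)) ((r - p) - (x - p)) ==
       kappa * crossv (- (x - p)) ((r - p) - (x - p))).
  have e1 : - (x - p) = p - x by rewrite opprB.
  have e2 : (r - p) - (x - p) = r - x by rewrite opprB addrA subrK.
  by rewrite e2 e1.
rewrite !cE => h h' c; apply: (addIr (- p)); move: h h' c.
move: (q - p) (q' - p) (r - p) => u u' d; rewrite !dotE /crossv !mxE.
move=> /andP[ne /eqP e] /andP[ne' /eqP e'] c.
suff [e0 e1] : u 0 0 = u' 0 0 /\ u 0 1 = u' 0 1 by exact: rV2P.
move: (u 0 0) (u 0 1) (u' 0 0) (u' 0 1) (d 0 0) (d 0 1) ne e ne' e' c.
move=> {u u' d cE} u1 u2 w1 w2 d1 d2 ne e ne' e' c.
pose v1 := d1 - kappa * d2; pose v2 := d2 + kappa * d1.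
have {}e : u1 ^+ 2 + u2 ^+ 2 = u1 * v1 + u2 * v2 by rewrite /v1 /v2; lra.
have {}e' : w1 ^+ 2 + w2 ^+ 2 = w1 * v1 + w2 * v2 by rewrite /v1 /v2; lra.
have {}c : u1 * w2 = w1 * u2 by lra.
(* The vector w times the difference of the two sides vanishes, while [ne'] forbids w = 0. With the
   symmetric [wv] this gives |u - w|^2 = 0. *)
have uv : u1 * w1 + u2 * w2 = u1 ^+ 2 + u2 ^+ 2.
  have f1 : w1 * (u1 * w1 + u2 * w2 - (u1 ^+ 2 + u2 ^+ 2)) = 0.
    transitivity (u1 * (w1 ^+ 2 + w2 ^+ 2) - w1 * (u1 ^+ 2 + u2 ^+ 2)
      - w2 * (u1 * w2 - w1 * u2));
    first ring.
    rewrite e e' c; transitivity (v2 * (u1 * w2 - w1 * u2));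
    first ring.
    by rewrite c; ring.
  have f2 : w2 * (u1 * w1 + u2 * w2 - (u1 ^+ 2 + u2 ^+ 2)) = 0.
    transitivity (u2 * (w1 ^+ 2 + w2 ^+ 2) - w2 * (u1 ^+ 2 + u2 ^+ 2)
      + w1 * (u1 * w2 - w1 * u2));
    first ring.
    rewrite e e' c; transitivity (- v1 * (u1 * w2 - w1 * u2));
    first ring.
    by rewrite c; ring.
  apply/eqP; rewrite -subr_eq0; apply: contraNT ne' => n0.
  move/eqP: f1; rewrite mulf_eq0 (negPf n0) orbF => /eqP ->.
  move/eqP: f2; rewrite mulf_eq0 (negPf n0) orbF => /eqP ->.
  by apply/eqP; ring.
have wv : u1 * w1 + u2 * w2 = w1 ^+ 2 + w2 ^+ 2.
  have f1 : u1 * (u1 * w1 + u2 * w2 - (w1 ^+ 2 + w2 ^+ 2)) = 0.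
    transitivity (w1 * (u1 ^+ 2 + u2 ^+ 2) - u1 * (w1 ^+ 2 + w2 ^+ 2)
      + u2 * (u1 * w2 - w1 * u2));
    first ring.
    rewrite e e' c; transitivity (- v2 * (u1 * w2 - w1 * u2));
    first ring.
    by rewrite c; ring.
  have f2 : u2 * (u1 * w1 + u2 * w2 - (w1 ^+ 2 + w2 ^+ 2)) = 0.
    transitivity (w2 * (u1 ^+ 2 + u2 ^+ 2) - u2 * (w1 ^+ 2 + w2 ^+ 2)
      - u1 * (u1 * w2 - w1 * u2));
    first ring.
    rewrite e e' c; transitivity (v1 * (u1 * w2 - w1 * u2));
    first ring.
    by rewrite c; ring.
  apply/eqP; rewrite -subr_eq0; apply: contraNT ne => n0.
  move/eqP: f1; rewrite mulf_eq0 (negPf n0) orbF => /eqP ->.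
  move/eqP: f2; rewrite mulf_eq0 (negPf n0) orbF => /eqP ->.
  by apply/eqP; ring.
have /eqP : (u1 - w1) ^+ 2 + (u2 - w2) ^+ 2 = 0.
  rewrite -[RHS](subrr (u1 * w1 + u2 * w2)) {1}uv; move: wv; lra.
rewrite paddr_eq0 ?sqr_ge0 // !sqrf_eq0 !subr_eq0 => /andP[/eqP -> /eqP ->].
by [].
Qed.

(* [q] is the only intersection other than [a] of a line through [a] and a
   circle through [a] and [b]. *)
Lemma cot_angle_pin kappa kappa' w a q q' b :
  cot_angle kappa w a q -> cot_angle kappa w a q' ->
  cot_angle kappa' a q b -> cot_angle kappa' a q' b -> q = q'.
Proof.
move=> h1 h2 h3 h4; exact: cot_angle_mid h3 h4 (cot_angle_ray h1 h2).
Qed.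

(** By Lagrange's identity the cosine fixes the ratio of the squared dot and cross products, hence
    the cotangent up to sign. *)
Lemma angle_cot p q r (alpha : R) : 0 < alpha < pi -> p != q -> q != r ->
    angle p q r = alpha ->
  exists b : bool, cot_angle ((-1) ^+ b * (cos alpha / sin alpha)) p q r.
Proof.
move=> a_pi pq qr; rewrite /angle /cot_angle.
set u := p - q; set w := r - q.
have nz (v : 'rV[R]_2) : v != 0 -> 0 < dot v v.
  move=> v0; rewrite dotE lt_neqAle addr_ge0 -?expr2 ?sqr_ge0 // andbT eq_sym.
  rewrite paddr_eq0 ?sqr_ge0 // !sqrf_eq0;
  apply: contra v0 => /andP[/eqP e0 /eqP e1].
  by apply/eqP/rV2P; rewrite mxE.
have u0 : 0 < dot u u by apply: nz; rewrite subr_eq0.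
have w0 : 0 < dot w w by apply: nz; rewrite subr_eq0 eq_sym.
have lagrange : dot u u * dot w w = dot u w ^+ 2 + crossv u w ^+ 2.
  by rewrite !dotE /crossv; ring.
set t := _ / _ => at_.
have tE : t ^+ 2 * (dot u u * dot w w) = dot u w ^+ 2.
  rewrite /t /enorm expr_div_n exprMn !sqr_sqrtr ?ltW // divfK //.
  by rewrite gt_eqF // mulr_gt0.
(* Cauchy-Schwarz, so that [acos] is inverted within its domain. *)
have t1 : -1 <= t <= 1.
  rewrite -ler_norml -(@ler_pXn2r _ 2) ?nnegrE // expr1n real_normK ?num_real //.
  rewrite -(@ler_pM2r _ (dot u u * dot w w)) ?mulr_gt0 // tE mul1r lagrange.
  by rewrite lerDl sqr_ge0.
have cosE : cos alpha = t by rewrite -at_ acosK // in_itv.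
have sin0 : 0 < sin alpha by apply: sin_gt0_pi.
have sc := cos2Dsin2 alpha; clearbody t.
have key : (sin alpha * dot u w) ^+ 2 = (cos alpha * crossv u w) ^+ 2.
  rewrite cosE in sc *; rewrite lagrange in tE.
  have {}sc : sin alpha ^+ 2 = 1 - t ^+ 2 by rewrite -sc addrC addKr.
  by rewrite !exprMn sc mulrBl mul1r -{1}tE; ring.
have c0 : crossv u w != 0.
  apply/eqP => c0; move: key (mulr_gt0 u0 w0).
  rewrite lagrange c0 mulr0 expr0n /= => /eqP.
  rewrite sqrf_eq0 mulf_eq0 gt_eqF //= => /eqP ->.
  by rewrite expr0n addr0 ltxx.
rewrite c0 /=; move/eqP: key; rewrite eqf_sqr => /orP[] /eqP key.
  exists false; rewrite expr0 mul1r; apply/eqP; apply: (mulfI (lt0r_neq0 sin0)).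
  by rewrite key; field; rewrite lt0r_neq0.
exists true; rewrite expr1; apply/eqP; apply: (mulfI (lt0r_neq0 sin0)).
by rewrite key; field; rewrite lt0r_neq0.
Qed.

End Angles.

(** * Pinned chains *)

(** Telescoping of ln (1 - x) <= -x at x = 1/(n+2). *)
Lemma harmonic_le_ln (R : realType) (n : nat) :
  \sum_(i < n.+1) (i.+1%:R)^-1 <= 1 + ln n.+1%:R :> R.
Proof.
elim: n => [|n IHn]; first by rewrite big_ord1 ln1 addr0 invr1.
rewrite big_ord_recr /=.
have pos m : 0 < m.+1%:R :> R by rewrite ltr0n.
have : ln (n.+1%:R / n.+2%:R) <= - n.+2%:R^-1 :> R.
  have -> : n.+1%:R / n.+2%:R = 1 + - n.+2%:R^-1 :> R.
    apply: (mulIf (lt0r_neq0 (pos n.+1))).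
    rewrite divfK ?lt0r_neq0 // mulrDl mulNr mulVf ?lt0r_neq0 // mul1r.
    by rewrite -(natr1 n.+1) addrK.
  by apply: le_ln1Dx; rewrite ltrN2 invf_lt1 // ltr1n.
rewrite ln_div ?posrE //; move: IHn.
set a := ln n.+1%:R; set b := ln _; set c := (n.+2%:R)^-1.
by set d := \sum_(i < _) _; lra.
Qed.

Lemma card_angle_triples (R : realType) (E : {fset 'rV[R]_2}) (kappa : R) :
  (#|[set z : E * E * E |
       cot_angle kappa (val z.1.1) (val z.1.2) (val z.2)]|)%:R <=
  6 * 2304 * #|{: E}|%:R ^+ 2 * \sum_(i < #|{: E}|) (i.+1%:R)^-1 :> R.
Proof.
pose X (p : E) := val p 0 0; pose Y (p : E) := val p 0 1.
have XY_inj p q : X p = X q -> Y p = Y q -> p = q.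
  by move=> h0 h1; apply/val_inj/rV2P.
have lineE p q r : (r \in line X Y p q) =
    (crossv (val q - val p) (val r - val p) == 0).
  by rewrite inE /crossv !mxE subr_eq0.
have le1 : (#|[set z : E * E * E |
    cot_angle kappa (val z.1.1) (val z.1.2) (val z.2)]| <= 2 * line_energy X Y)%N.
  apply: (card_angles
    (A := fun p q r => cot_angle kappa (val p) (val q) (val r))).
  - by move=> p q r /cot_angle_neq.
  - by move=> p q r r' h h'; rewrite lineE; apply/eqP; apply: cot_angle_ray h h'.
  - move=> p p' q r /cot_angle_rev h /cot_angle_rev h'; rewrite lineE; apply/eqP.
    exact: cot_angle_ray h h'.
  - move=> p q q' r h h'; rewrite lineE => /eqP c.
    exact/val_inj/(cot_angle_mid h h' c).
  - move=> p q q' r /cot_angle_rev h /cot_angle_rev h'; rewrite lineE => /eqP c.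
    exact/val_inj/(cot_angle_mid h h' c).
rewrite (le_trans (_ : _ <= (2 * line_energy X Y)%:R)) ?ler_nat // natrM.
by have := line_energy_le XY_inj; lra.
Qed.

Section Chains.
Variables (R : realType) (E : {fset 'rV[R]_2}) (k : nat).
Local Notation tuple := (k.+1.-tuple E).

(** The point x_(i+1), the origin having index 0; parities of indices are thus opposite to those of
    the x's. *)
Definition vertex (t : tuple) (i : nat) : 'rV[R]_2 :=
  nth 0 (0 :: [seq val x | x <- t]) i.

Lemma vertexS t i (ik : (i < k.+1)%N) :
  vertex t i.+1 = val (tnth t (Ordinal ik)).
Proof.
rewrite (tnth_nth (tnth t ord0)) /vertex /=.
by rewrite (nth_map (tnth t ord0)) ?size_tuple.
Qed.

Lemma vertex_inj t t' : (forall i, (i <= k.+1)%N -> vertex t i = vertex t' i) ->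
  t = t'.
Proof.
move=> h; apply: eq_from_tnth => -[i ik]; apply/val_inj.
by have := h i.+1 ik; rewrite !vertexS.
Qed.

Definition cot_chains (beta : 'I_k -> R) : {set tuple} :=
  [set t | [forall j : 'I_k,
     cot_angle (beta j) (vertex t j) (vertex t j.+1) (vertex t j.+2)]].

Lemma cot_chainsP beta t j (jk : (j < k)%N) : t \in cot_chains beta ->
  cot_angle (beta (Ordinal jk)) (vertex t j) (vertex t j.+1) (vertex t j.+2).
Proof. by rewrite inE => /forallP/(_ (Ordinal jk)). Qed.

(** The odd vertices, entries 0, 2, ..., k of the tuple, are recorded. The even ones follow from the
    origin onwards by [cot_angle_pin]. *)
Lemma card_cot_chains_even beta : ~~ odd k ->
  (#|cot_chains beta| <= #|{: E}| ^ (k./2 + 1))%N.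
Proof.
move=> evk; have kE : k = k./2.*2 by rewrite even_halfK.
pose F (t : tuple) := [ffun i : 'I_(k./2 + 1) => tnth t (inord i.*2)].
rewrite -[X in (_ ^ X)%N]card_ord -card_ffun -(@card_in_imset _ _ F).
  exact: max_card.
move=> t t' tc tc' /ffunP FF.
have odds i : (i <= k./2)%N -> vertex t i.*2.+1 = vertex t' i.*2.+1.
  move=> le_ik; have ik : (i < k./2 + 1)%N by rewrite addn1.
  have := FF (Ordinal ik); rewrite !ffunE /=.
  have i2k : (i.*2 < k.+1)%N by lia.
  rewrite !(vertexS _ i2k) (_ : inord _ = Ordinal i2k) => [->//|].
  exact/val_inj/inordK.
have evens i : (i <= k./2)%N -> vertex t i.*2 = vertex t' i.*2.
  elim: i => [//|i IHi] ik.
  have j1 : (i.*2 < k)%N by lia.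
  have j2 : (i.*2.+1 < k)%N by lia.
  have := cot_chainsP j1 tc; have := cot_chainsP j2 tc.
  have := cot_chainsP j1 tc'; have := cot_chainsP j2 tc'.
  rewrite -IHi ?(ltnW ik) // -(odds i) ?(ltnW ik) //.
  rewrite -[i.*2.+3]/(i.+1.*2.+1) -(odds _ ik).
  by move=> a b c d; apply: cot_angle_pin d b c a.
apply: vertex_inj => i ik; rewrite -(odd_double_half i).
by case: (odd i) (odd_double_half i) => /= hi; [apply: odds|apply: evens]; lia.
Qed.

(** With k = 2m+3, the last three vertices form an angle triple, and [F] also records the vertices
    2, 4, ..., 2m. All even vertices and the odd vertex [k] are then known. *)
Lemma card_cot_chains_odd beta m (km : k = m.+1.*2.+1) (lk : (m.+1.*2 < k)%N) :
  (#|cot_chains beta| <= #|[set z : E * E * E |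
     cot_angle (beta (Ordinal lk)) (val z.1.1) (val z.1.2) (val z.2)]|
    * #|{: E}| ^ m)%N.
Proof.
pose F (t : tuple) := ((tnth t (inord m.*2.+1), tnth t (inord m.*2.+2),
  tnth t (inord m.*2.+3)), [ffun i : 'I_m => tnth t (inord i.*2.+1)]).
have vE t i : (i < k.+1)%N -> vertex t i.+1 = val (tnth t (inord i)).
  move=> ik; rewrite (vertexS _ ik) (_ : inord i = Ordinal ik) //.
  exact/val_inj/inordK.
rewrite -[X in (_ ^ X)%N]card_ord -card_ffun -cardsT -cardsX.
rewrite -(@card_in_imset _ _ F).
  apply/subset_leq_card/subsetP => y /imsetP[t tc ->]; rewrite !inE andbT /=.
  by rewrite -!vE ?(cot_chainsP _ tc) //; lia.
move=> t t' tc tc' [e1 e2 e3] /ffunP FF.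
have same i : (i < k.+1)%N -> tnth t (inord i) = tnth t' (inord i) ->
    vertex t i.+1 = vertex t' i.+1.
  by move=> ik e; rewrite !vE ?e.
have evens i : (i <= m.+2)%N -> vertex t i.*2 = vertex t' i.*2.
  case: i => [//|i]; rewrite !ltnS leq_eqVlt => /orP[/eqP ->|].
    by apply: (same m.*2.+3) => //; lia.
  rewrite ltnS leq_eqVlt => /orP[/eqP ->|im].
    by apply: (same m.*2.+1) => //; lia.
  by apply: (same i.*2.+1); [lia | have := FF (Ordinal im); rewrite !ffunE].
(* Induction from the last odd vertex down to the first; reading the chain backwards is why the
   angles are reversed. *)
have odds i : (i <= m.+1)%N ->
    vertex t (m.+1 - i).*2.+1 = vertex t' (m.+1 - i).*2.+1.
  elim: i => [_|i IHi im]; first by rewrite subn0; apply: (same m.*2.+2) => //; lia.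
  have {}IHi := IHi (ltnW im); set j := (m.+1 - i.+1)%N.
  have jE : (m.+1 - i = j.+1)%N by rewrite /j; lia.
  rewrite jE in IHi.
  have j1 : (j.*2 < k)%N by lia.
  have j2 : (j.*2.+1 < k)%N by lia.
  have := cot_chainsP j1 tc; have := cot_chainsP j2 tc.
  have := cot_chainsP j1 tc'; have := cot_chainsP j2 tc'.
  rewrite -(evens j) -1?[j.*2.+2]/(j.+1.*2) -1?(evens j.+1)
    -1?[j.*2.+3]/(j.+1.*2.+1) -?IHi; try lia.
  move=> /cot_angle_rev a /cot_angle_rev b /cot_angle_rev c /cot_angle_rev d.
  exact: cot_angle_pin c a d b.
apply: vertex_inj => i ik; rewrite -(odd_double_half i).
case: (odd i) (odd_double_half i) => /= hi; last by apply: evens; lia.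
have := odds (m.+1 - i./2)%N (leq_subr _ _).
by rewrite subKn //; lia.
Qed.

(** By [angle_cot], each pinned chain lies in [cot_chains] for at least one of the 2^k choices of
    signs. *)
Lemma num_pinned_chains_le (alpha : 'I_k -> R) (B : R) :
    (forall j, 0 < alpha j < pi) ->
    (forall beta, #|cot_chains beta|%:R <= B) ->
  (num_pinned_chains alpha E)%:R <= 2 ^+ k * B.
Proof.
move=> halpha hB.
pose beta (s : {ffun 'I_k -> bool}) j :=
  (-1) ^+ s j * (cos (alpha j) / sin (alpha j)).
pose A := [set t : tuple | pinned_chain alpha t].
have -> : num_pinned_chains alpha E = #|A| by apply: eq_card => t; rewrite !inE.
have <- : \sum_(s : {ffun 'I_k -> bool}) B = 2 ^+ k * B.
  by rewrite sumr_const card_ffun card_bool card_ord -[LHS]mulr_natl natrX.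
apply: le_trans (ler_sum _ (fun s _ => hB (beta s))).
rewrite -natr_sum ler_nat.
apply: (@leq_trans (\sum_s #|[set t in A | t \in cot_chains (beta s)]|));
  last first.
  apply: leq_sum => s _.
  by apply/subset_leq_card/subsetP => t; rewrite inE => /andP[].
rewrite sum_card_exchange -sum1_card leq_sum // => t; rewrite inE => /forallP h.
have hb (j : 'I_k) : exists b : bool, cot_angle
    ((-1) ^+ b * (cos (alpha j) / sin (alpha j)))
    (vertex t j) (vertex t j.+1) (vertex t j.+2).
  by have /and3P[h1 h2 /eqP h3] := h j; apply: angle_cot.
have [s hs] := choice hb.
apply/card_gt0P; exists [ffun j => s j]; rewrite !inE.
by apply/forallP => j; rewrite /beta ffunE.
Qed.

End Chains.

Theorem theorem2p7 (R : realType) (k : nat) (alpha : 'I_k -> R)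
    (hk : (2 <= k)%N) (halpha : forall j : 'I_k, 0 < alpha j < pi) :
  exists (C : R) (N : nat), forall n : nat, (N < n)%N ->
    forall E : {fset 'rV[R]_2}, #|` E|%fset = n ->
      (num_pinned_chains alpha E)%:R <=
        C * (if odd k then n%:R ^+ ((k.-1)./2 + 1) * ln n%:R
             else n%:R ^+ (k./2 + 1)).
Proof.
(* Beyond the integer part of e one has ln n >= 1, so 1 + ln n <= 2 ln n; this doubles the 6 of
   [card_angle_triples]. *)
exists (2 ^+ k * (12 * 2304)), (Num.truncn (expR 1 : R)) => n Nn E cE.
rewrite -mulrA; apply: num_pinned_chains_le => // beta.
have cardE : #|{: E}| = n by rewrite -cE cardfE.
have e_le_n : expR 1 <= n%:R :> R.
  by rewrite ltW // -truncn_lt_nat // expR_ge0.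
have n0 : 0 < n%:R :> R by apply: lt_le_trans e_le_n; apply: expR_gt0.
have ln_ge1 : 1 <= ln n%:R :> R.
  by rewrite -[leLHS]expRK ler_ln ?posrE ?expR_gt0.
case: ifPn => [k_odd|k_even]; last first.
  have := card_cot_chains_even E beta k_even.
  rewrite cardE -(ler_nat R) natrX => /le_trans; apply.
  by rewrite ler_peMl ?exprn_ge0 ?(ltW n0) //; lra.
(* By [hk] an odd [k] is at least 3. *)
have [m km] : exists m, k = m.+1.*2.+1.
  exists (k./2.-1); have := odd_double_half k; rewrite k_odd; lia.
have lk : (m.+1.*2 < k)%N by rewrite km.
have le1 : #|cot_chains E beta|%:R <= (#|[set z : E * E * E | cot_angle
    (beta (Ordinal lk)) (val z.1.1) (val z.1.2) (val z.2)]|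
    * #|{: E}| ^ m)%:R :> R.
  by rewrite ler_nat; apply: (@card_cot_chains_odd R E k beta m km lk).
apply: le_trans le1 _; rewrite natrM natrX cardE.
have := card_angle_triples E (beta (Ordinal lk)); rewrite cardE.
have : \sum_(i < n) (i.+1%:R)^-1 <= 1 + ln n%:R :> R.
  by case: (n) n0 => [|n' _]; [rewrite ltxx | exact: harmonic_le_ln].
have -> : ((k.-1)./2 + 1 = 2 + m)%N by rewrite km /= doubleK; lia.
set S := \sum_(i < n) _; set W := (#|_|%:R : R) => hS hW.
rewrite exprD [_ * ln _]mulrAC mulrA ler_wpM2r ?exprn_ge0 ?(ltW n0) //.
apply: (le_trans hW).
have -> (a b : R) : 12 * 2304 * (a * b) = 6 * 2304 * a * (2 * b) by ring.
rewrite ler_wpM2l ?mulr_ge0 ?exprn_ge0 ?(ltW n0) //.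
by rewrite (le_trans hS) // mulr_natl mulr2n lerD2r.
Qed.
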